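(* For every $n\ge 1$ and every unlabeled binary tree $T\in\mathrm{URL}_n$, \[ \sum_{\sigma \in \mathrm{And}^{I}(T)} s^{\mathrm{ides}(\sigma)} =\sum_{\sigma \in \mathrm{And}^{II}(T)} s^{\mathrm{ides}(\sigma)} =\sum_{\sigma \in \mathrm{RS}(T)} s^{\mathrm{ides}(\sigma)}. \]
   Context: A binary tree is a rooted tree in which every vertex has no child, a single left child, a single right child, or both. The map $\Psi$ sends a word $\pi$ of distinct integers to an increasing binary tree: $\Psi(\emptyset)=\emptyset$; otherwise write $\pi=\sigma\, i\,\tau$ with $i$ the least letter, and let $\Psi(\pi)$ have root $i$, left subtree $\Psi(\sigma)$, right subtree $\Psi(\tau)$. The shape of a labeled tree is its underlying unlabeled binary tree. $\mathrm{URL}_n$ is the set of unlabeled rooted binary trees with $n$ vertices in which no vertex has a left child but no right child. Andr\'e permutations: the empty word and one-letter words are Andr\'e I and Andr\'e II; a word $\sigma$ of $n\ge2$ distinct integers, written $\sigma=\tau\,\min(\sigma)\,\tau'$, is Andr\'e I (resp. II) if $\tau,\tau'$ are Andr\'e I (resp. II) and the largest (resp. smallest) letter of $\tau\tau'$ lies in $\tau'$. A permutation $\sigma$ of $[n]$ is simsun if $\sigma_n=n$ and for each $k\in[n]$ the subword formed by the letters $1,\dots,k$ has no index $i$ with $w_i>w_{i+1}>w_{i+2}$. For $T\in\mathrm{URL}_n$, $\mathrm{And}^{I}(T)$, $\mathrm{And}^{II}(T)$, $\mathrm{RS}(T)$ denote the sets of Andr\'e I, Andr\'e II, and simsun permutations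 $\sigma$ of $[n]$ respectively with $\mathrm{shape}(\Psi(\sigma))=T$. $\mathrm{ides}(\sigma)$ is the number of descents of $\sigma^{-1}$, i.e. the number of $i\in[n-1]$ such that $i+1$ appears to the left of $i$ in $\sigma$. *)

(* Defs.v *)
From HB Require Import structures.
From mathcomp Require Import all_boot all_algebra.
Set Implicit Arguments. Unset Strict Implicit. Unset Printing Implicit Defensive.
Import GRing.Theory.

Inductive btree := BLeaf | BNode of btree & btree.

Fixpoint btree_eqb (t u : btree) : bool :=
  match t, u with
  | BLeaf, BLeaf => true
  | BNode l r, BNode l' r' => btree_eqb l l' && btree_eqb r r'
  | _, _ => false
  end.

Lemma btree_eqP : Equality.axiom btree_eqb.
Proof.
elim=> [|l IHl r IHr] [|l' r'] /=; try by constructor.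
case: (IHl l') => [->|h]; last by constructor; case.
case: (IHr r') => [->|h]; last by constructor; case.
by constructor.
Qed.

HB.instance Definition _ := hasDecEq.Build btree btree_eqP.

Fixpoint bsize (t : btree) : nat :=
  if t is BNode l r then (bsize l + bsize r).+1 else 0.

Fixpoint url (t : btree) : bool :=
  match t with
  | BLeaf => true
  | BNode l r => [&& ~~ ((l != BLeaf) && (r == BLeaf)), url l & url r]
  end.

Inductive ltree := LLeaf | LNode of ltree & nat & ltree.

Fixpoint shape (t : ltree) : btree :=
  if t is LNode l _ r then BNode (shape l) (shape r) else BLeaf.

Definition seqmin (w : seq nat) : nat := foldr minn (head 0 w) w.
Definition seqmax (w : seq nat) : nat := foldr maxn (head 0 w) w.

Fixpoint Psi_aux (k : nat) (w : seq nat) : ltree :=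
  match k with
  | 0 => LLeaf
  | k'.+1 =>
    if w is [::] then LLeaf else
    let m := seqmin w in
    let i := index m w in
    LNode (Psi_aux k' (take i w)) m (Psi_aux k' (drop i.+1 w))
  end.

Definition Psi (w : seq nat) : ltree := Psi_aux (size w) w.

Fixpoint andre_aux (kind : bool) (k : nat) (w : seq nat) : bool :=
  match k with
  | 0 => true
  | k'.+1 =>
    if size w <= 1 then true else
    let i := index (seqmin w) w in
    let tau := take i w in
    let tau' := drop i.+1 w in
    [&& andre_aux kind k' tau, andre_aux kind k' tau' &
        (if kind then seqmax (tau ++ tau') \in tau'
         else seqmin (tau ++ tau') \in tau')]
  end.

Definition AndreI (w : seq nat) : bool := andre_aux true (size w) w.
Definition AndreII (w : seq nat) : bool := andre_aux false (size w) w.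

Definition no_double_descent (w : seq nat) : bool :=
  all (fun i => ~~ ((nth 0 w i.+1 < nth 0 w i) && (nth 0 w i.+2 < nth 0 w i.+1)))
      (iota 0 (size w - 2)).

Definition simsun (n : nat) (sigma : seq nat) : bool :=
  (last 0 sigma == n) &&
  all (fun k => no_double_descent [seq x <- sigma | x <= k]) (iota 1 n).

Definition ides (n : nat) (sigma : seq nat) : nat :=
  count (fun i => index i.+1 sigma < index i sigma) (iota 1 n.-1).

Definition perms (n : nat) : seq (seq nat) := permutations (iota 1 n).

Definition And1 (n : nat) (T : btree) : seq (seq nat) :=
  [seq sigma <- perms n | AndreI sigma && (shape (Psi sigma) == T)].
Definition And2 (n : nat) (T : btree) : seq (seq nat) :=
  [seq sigma <- perms n | AndreII sigma && (shape (Psi sigma) == T)].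
Definition RS (n : nat) (T : btree) : seq (seq nat) :=
  [seq sigma <- perms n | simsun n sigma && (shape (Psi sigma) == T)].

(* Main.v *)
Require Import Defs.
From mathcomp Require Import all_boot all_algebra.
From mathcomp Require Import zify.
Import GRing.Theory.
Local Open Scope ring_scope.

Set Implicit Arguments. Unset Strict Implicit. Unset Printing Implicit Defensive.

(* Cut a word at its least letter, sigma = tau m tau'.  A double descent is a
   vertex with a left but no right child, so simsun words are those for which
   tau is Andre II, tau' is simsun and the largest letter of tau tau' lies in
   tau'.  All three families thus obey the same recursion, except that either
   the largest letter (I, simsun) or the smallest one (II) is forced into tau'.

   Reading the letters other than m in increasing order gives a shuffle of those
   of tau with those of tau', i.e. an alternation of blocks.  The inverse
   descents of sigma are those of tau and tau' inside a block, plus one at the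
   start of each block of tau.  Counting shuffles by the number k of blocks of
   tau, the blocks of tau' number k or k + 1 whether the shuffle is forced to
   end or to begin in tau', so both sums equal
     sum_k [x^k] P * ([y^k] Q + [y^(k+1)] Q),
   where P and Q are products over the letters of tau and tau', in which each
   letter continues a block or opens a new one.  This depends only on the sizes
   and numbers of inverse descents of tau and tau', whence the induction. *)

(** * Shuffle masks and descent bits of a shuffle *)

(** The masks with [a] true and [b] false bits; the inner [fix] is there because a step decreases
    either argument. *)
Fixpoint masks (a : nat) : nat -> seq bitseq :=
  fix masks_a (b : nat) : seq bitseq :=
    match a with
    | 0 => if b is b'.+1 then map (cons false) (masks_a b') else [:: [::]]
    | a'.+1 => map (cons true) (masks a' b) ++
               (if b is b'.+1 then map (cons false) (masks_a b') else [::])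
    end.

Lemma masks0S b : masks 0 b.+1 = map (cons false) (masks 0 b).
Proof. by []. Qed.

Lemma masksS0 a : masks a.+1 0 = map (cons true) (masks a 0).
Proof. by rewrite /= cats0. Qed.

Lemma masksSS a b :
  masks a.+1 b.+1 = map (cons true) (masks a b.+1) ++ map (cons false) (masks a.+1 b).
Proof. by []. Qed.

Lemma mem_cons_map (b c : bool) (C : bitseq) (s : seq bitseq) :
  (c :: C \in map (cons b) s) = (c == b) && (C \in s).
Proof.
apply/mapP/andP => [[C' C's [-> ->]]|[/eqP -> Cs]]; first by rewrite eqxx.
by exists C.
Qed.

Lemma mem_masks a b (C : bitseq) :
  (C \in masks a b) = (count id C == a) && (count negb C == b).
Proof.
elim: C a b => [|c C IH] [|a] [|b];
  rewrite ?masks0S ?masksS0 ?masksSS ?mem_cat ?mem_cons_map ?IH //.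
- by apply/negbTE/mapP => -[].
- by apply/negbTE/mapP => -[].
- by apply/negbTE/negP => /orP[] /mapP[].
- by case: c; rewrite /= ?andbF.
- by case: c; rewrite /= ?add1n ?add0n ?eqSS.
- by case: c; rewrite /= ?add1n ?add0n ?eqSS ?andbF.
- by case: c; rewrite /= ?add1n ?add0n ?eqSS ?orbF.
Qed.

Lemma size_mask_of a b (C : bitseq) : C \in masks a b -> size C = (a + b)%N.
Proof. by rewrite mem_masks => /andP[/eqP <- /eqP <-]; rewrite count_predC. Qed.

Lemma masks_uniq a b : uniq (masks a b).
Proof.
have cons_inj (c : bool) : injective (cons c) by move=> x y [].
elim: a b => [|a IHa]; elim=> [|b IHb] //.
- by rewrite masks0S map_inj_uniq.
- by rewrite masksS0 map_inj_uniq.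
- rewrite masksSS cat_uniq !(map_inj_uniq (@cons_inj _)) IHa IHb andbT /=.
  by apply/hasPn => _ /mapP[C _ ->]; rewrite mem_cons_map.
Qed.

(* Descent bits of a shuffle, where a bit of the mask is [true] on the letters
   of tau.  Each bit of [du], [dv] compares a letter with the preceding one of
   the same word; [c] tells whether the last letter read is in tau. *)
Fixpoint merge_des (c : bool) (C du dv : bitseq) : bitseq :=
  match C with
  | [::] => [::]
  | true :: C' => (if c then head false du else true) :: merge_des true C' (behead du) dv
  | false :: C' => (if c then false else head false dv) :: merge_des false C' du (behead dv)
  end.

Lemma size_merge_des c C du dv : size (merge_des c C du dv) = size C.
Proof. by elim: C c du dv => [|[] C IH] c du dv //=; rewrite IH. Qed.

(** André I, André II and simsun; [lkind] is the kind of the left factor tau, and [okmask] forces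
    the first or last letter of the shuffle into tau'. The default [false] accepts the empty
    mask. *)
Variant kind := KI | KII | KRS.
Definition lkind (K : kind) : kind := if K is KI then KI else KII.
Definition okmask (K : kind) (C : bitseq) : bool :=
  if K is KII then ~~ head false C else ~~ last false C.

(** * Generating function of shuffles by inverse descents *)

Section MergeSum.
Variables (A : comNzRingType) (s : A).

(** Pairs the blocks of tau, counted by the exponent in [p], with equally many blocks of tau',
    counted in [q]. *)
Definition dotp (p q : {poly A}) : A := \sum_(i < size q) p`_i * q`_i.

Lemma dotp_widen (p q : {poly A}) n :
  (size q <= n)%N -> dotp p q = \sum_(i < n) p`_i * q`_i.
Proof.
move=> le_qn; rewrite /dotp (big_ord_widen _ (fun i => p`_i * q`_i) le_qn).
rewrite big_mkcond; apply: eq_bigr => i _; case: ltnP => // le_qi.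
by rewrite [q`_i]nth_default // mulr0.
Qed.

Lemma dotpDl p1 p2 q : dotp (p1 + p2) q = dotp p1 q + dotp p2 q.
Proof. by rewrite -big_split; apply: eq_bigr => i _; rewrite coefD mulrDl. Qed.

Lemma dotpZl a p q : dotp (a *: p) q = a * dotp p q.
Proof. by rewrite big_distrr; apply: eq_bigr => i _; rewrite coefZ -mulrA. Qed.

Lemma dotpDr p q1 q2 : dotp p (q1 + q2) = dotp p q1 + dotp p q2.
Proof.
pose n := maxn (size (q1 + q2)) (maxn (size q1) (size q2)).
rewrite !(@dotp_widen _ _ n) ?leq_max ?leqnn ?orbT // -big_split.
by apply: eq_bigr => i _; rewrite coefD mulrDr.
Qed.

Lemma dotpZr a p q : dotp p (a *: q) = a * dotp p q.
Proof.
rewrite (dotp_widen _ (size_scale_leq a q)) big_distrr.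
by apply: eq_bigr => i _; rewrite coefZ mulrCA.
Qed.

Lemma dotp_shift p q : dotp ('X * p) ('X * q) = dotp p q.
Proof.
have le : (size ('X * q)%R <= (size q).+1)%N.
  by apply: leq_trans (size_polyMleq _ _) _; rewrite size_polyX.
rewrite (dotp_widen _ le) big_ord_recl !coefXM mul0r add0r.
by apply: eq_bigr => i _; rewrite !coefXM.
Qed.

Lemma dotp1 q : dotp 1 q = q`_0.
Proof.
rewrite (@dotp_widen _ _ (size q).+1) // big_ord_recl coef1 mul1r big1 ?addr0 //.
by move=> i _; rewrite coef1 mul0r.
Qed.

Lemma dotpr1 p : dotp p 1 = p`_0.
Proof. by rewrite /dotp size_poly1 big_ord1 coef1 mulr1. Qed.

(* A letter either continues the current block of its word or, at the price of
   a factor ['X], opens a new one. *)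
Definition ublocks (du : bitseq) : {poly A} :=
  \prod_(d <- du) ((s ^+ d)%:P + s *: 'X).
Definition vblocks (dv : bitseq) : {poly A} :=
  \prod_(e <- dv) ((s ^+ e)%:P + 'X).
(** Used when the last letter read belongs to the other word: the first letter must then open a
    block, and its own bit is dropped. *)
Definition ublocks_new (du : bitseq) : {poly A} :=
  if du is _ :: du' then s *: ('X * ublocks du') else 1.
Definition vblocks_new (dv : bitseq) : {poly A} :=
  if dv is _ :: dv' then 'X * vblocks dv' else 1.

(* With [e], the shuffle has to end in tau'; otherwise it may also end in tau,
   and there is then one block of tau' less. *)
Definition endw (e : bool) : {poly A} := if e then 1 else 1 + 'X.

(** Induction on the first bit of the mask. If [c] holds, a block of tau is already open: the extra
    ['X] counts it, and the next letter of tau' has to open a block. *)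
Lemma sum_merge (e c : bool) (du dv : bitseq) :
  \sum_(C <- masks (size du) (size dv) | e ==> ~~ last c C)
     s ^+ count id (merge_des c C du dv) =
  if c then dotp ('X * ublocks du) (endw e * vblocks_new dv)
  else dotp (ublocks_new du) (endw e * vblocks dv).
Proof.
have uC d du' : ublocks (d :: du') = s ^+ d *: ublocks du' + s *: ('X * ublocks du').
  by rewrite /ublocks big_cons mulrDl mul_polyC scalerAl.
have vC d dv' : vblocks (d :: dv') = s ^+ d *: vblocks dv' + 'X * vblocks dv'.
  by rewrite /vblocks big_cons mulrDl mul_polyC.
have dz p q : dotp ('X * p) ('X * q) = dotp p q := dotp_shift p q.
elim: du c dv => [|d du IHu] c dv; elim: dv c => [|f dv IHv] c.
- rewrite /= big_mkcond big_seq1 /= expr0 /ublocks /vblocks !big_nil !mulr1 dotp1.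
  case: c; case: e => //=; rewrite ?dotpr1 ?coefX ?dotpDr ?dotpr1 ?coefX ?coefD ?coef1 ?coefX ?addr0 //.
  by rewrite -[X in dotp _ X]mulr1 -[X in dotp X _]mulr1 dz dotp1 coef1 add0r.
- rewrite masks0S big_map /=.
  under eq_bigl => C do rewrite /=.
  under eq_bigr => C _ do rewrite /= exprD.
  rewrite -big_distrr /= (IHv false) {IHv} /ublocks_new /ublocks big_nil.
  case: c; last by rewrite vC mulrDr -scalerAr mulrCA dotpDr dotpZr !dotp1 coefXM addr0.
  by rewrite expr0 mul1r mulrCA dz.
- rewrite [size [::]]/= masksS0 big_map.
  under eq_bigr => C _ do rewrite /= exprD.
  rewrite -big_distrr /= (IHu true [::]) {IHu} /vblocks_new /vblocks big_nil mulr1.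
  case: c; last by rewrite dotpZl expr1.
  rewrite uC mulrDr -!scalerAr dotpDl !dotpZl.
  (* Once tau' is exhausted no further block of tau can open: [endw e] has degree at most 1, so a
     multiple of ['X] squared pairs to 0 with it. *)
  suff -> : dotp ('X * ('X * ublocks du)) (endw e) = 0 by rewrite mulr0 addr0.
  case: e; first by rewrite dotpr1 coefXM.
  by rewrite dotpDr dotpr1 coefXM -['X in X in dotp _ X]mulr1 dz dotpr1 coefXM addr0.
- rewrite masksSS big_cat !big_map /=.
  under eq_bigr => C _ do rewrite exprD.
  under [X in _ + X]eq_bigr => C _ do rewrite exprD.
  rewrite -!big_distrr /= (IHu true (f :: dv)) (IHv false) {IHu IHv}.
  case: c => /=.
    by rewrite uC mulrDr -!scalerAr dotpDl !dotpZl expr0 mul1r mulrCA !dz.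
  by rewrite vC mulrDr -!scalerAr dotpDr dotpZr expr1 addrC !dotpZl.
 
Qed.

Lemma sum_merge_last (du dv : bitseq) :
  \sum_(C <- masks (size du) (size dv) | ~~ last false C)
     s ^+ count id (merge_des false C du dv) = dotp (ublocks_new du) (vblocks dv).
Proof. by rewrite (sum_merge true false) mul1r. Qed.

(** Removing the forced first letter of tau' frees the end of the shuffle, which costs [1 + 'X].
    This is exactly the factor of a first letter with bit [false] in [vblocks dv]. *)
Lemma sum_merge_head (du dv : bitseq) : head false dv = false ->
  \sum_(C <- masks (size du) (size dv) | ~~ head false C)
     s ^+ count id (merge_des false C du dv) = dotp (ublocks_new du) (vblocks dv).
Proof.
case: dv => [_|e dv /= ->]; first case: du => [|d du].
- by rewrite -sum_merge_last big_mkcond [RHS]big_mkcond /= !big_seq1.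
- rewrite [size [::]]/= masksS0 big_map big_pred0 // /vblocks big_nil dotpr1.
  by rewrite /= coefZ coefXM mulr0.
have cons_false (P : bitseq -> A) :
    \sum_(C <- masks (size du) (size dv).+1 | ~~ head false C) P C =
    \sum_(C <- masks (size du) (size dv)) P (false :: C).
  case: (size du) => [|a]; first by rewrite masks0S big_map.
  by rewrite masksSS big_cat !big_map /= big_pred0 // add0r.
rewrite {}cons_false /= (sum_merge false false).
by rewrite /vblocks big_cons expr0 polyC1.
Qed.

Lemma prod_bits (V : comNzRingType) (f : bool -> V) (d : bitseq) :
  \prod_(x <- d) f x = f true ^+ count id d * f false ^+ (size d - count id d).
Proof.
rewrite -(count_predC id d) addKn; elim: d => [|[] d IH] /=.
- by rewrite big_nil mul1r.
- by rewrite big_cons IH add1n add0n exprS mulrA.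
- by rewrite big_cons IH add1n add0n exprS mulrCA.
Qed.

(** Block polynomials as functions of the length [n] and the number [k] of true bits. In [uweight]
    the first bit is false, so all [k] are among the other [n']. *)
Definition vweight (n k : nat) : {poly A} :=
  ((s ^+ true)%:P + 'X) ^+ k * ((s ^+ false)%:P + 'X) ^+ (n - k).
Definition uweight (n k : nat) : {poly A} :=
  if n is n'.+1 then
    s *: ('X * (((s ^+ true)%:P + s *: 'X) ^+ k * ((s ^+ false)%:P + s *: 'X) ^+ (n' - k)))
  else 1.

Lemma vblocksE (d : bitseq) : vblocks d = vweight (size d) (count id d).
Proof. exact: (prod_bits (fun b => (s ^+ b)%:P + 'X)). Qed.

Lemma ublocks_newE (d : bitseq) :
  head false d = false -> ublocks_new d = uweight (size d) (count id d).
Proof.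
by case: d => //= _ d ->; rewrite /ublocks (prod_bits (fun b => (s ^+ b)%:P + s *: 'X)).
Qed.

(** The right side is free of [K]: forcing the first or the last letter gives the same sum. *)
Lemma sum_okmask (K : kind) (du dv : bitseq) :
  head false du = false -> head false dv = false ->
  \sum_(C <- masks (size du) (size dv) | okmask K C)
     s ^+ count id (merge_des false C du dv) =
  dotp (uweight (size du) (count id du)) (vweight (size dv) (count id dv)).
Proof.
move=> du0 dv0; rewrite -ublocks_newE // -vblocksE.
by case: K; rewrite /= ?sum_merge_head // sum_merge_last.
Qed.

End MergeSum.

(** * Equidistribution of descent bits along a tree *)

(** A model, without words, of the inverse descents of the words of kind [K] and shape [T], with
    multiplicity; the leading [false] belongs to the root. *)
Fixpoint desbits (K : kind) (T : btree) : seq bitseq :=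
  if T is BNode l r then
    [seq false :: merge_des false C p.1 p.2 |
       C <- [seq C <- masks (bsize l) (bsize r) | okmask K C],
       p <- [seq (x, y) | x <- desbits (lkind K) l, y <- desbits K r]]
  else [:: [::]].

Lemma desbits_wf K T d : d \in desbits K T -> size d = bsize T /\ head false d = false.
Proof.
case: T => [|l r] /=; first by rewrite inE => /eqP ->.
case/allpairsPdep => C [p] [/[!mem_filter]/andP[_ Cm] _ ->] /=; split=> //.
by rewrite size_merge_des (size_mask_of Cm).
Qed.

Lemma big_desbits (V : nmodType) K l r (f : bitseq -> V) :
  \sum_(d <- desbits K (BNode l r)) f d =
  \sum_(u <- desbits (lkind K) l) \sum_(v <- desbits K r)
    \sum_(C <- masks (bsize l) (bsize r) | okmask K C) f (false :: merge_des false C u v).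
Proof.
rewrite /= big_allpairs_dep big_filter.
under eq_bigr => C _ do rewrite big_allpairs_dep /=.
rewrite exchange_big; apply: eq_bigr => u _.
by rewrite exchange_big.
Qed.

(** The coefficient of ['X^j] is the multiplicity of [j], which the integers do not lose. Thus
    equality of sums at ['X] yields equality of multisets, usable over any ring. *)
Lemma perm_eq_genpoly (l1 l2 : seq nat) :
  \sum_(i <- l1) 'X^i = \sum_(i <- l2) 'X^i :> {poly int} -> perm_eq l1 l2.
Proof.
have coef_gen l j : (\sum_(i <- l) 'X^i : {poly int})`_j = (count_mem j l)%:R.
  rewrite coef_sum -sum1_count natr_sum [RHS]big_mkcond.
  apply: eq_bigr => i _; rewrite coefXn /= [i == j]eq_sym. by case: eqP.
move=> eql; apply/allP => j _; apply/eqP.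
have := congr1 (fun p : {poly int} => p`_j) eql.
by rewrite !coef_gen => /eqP; rewrite Num.Theory.eqr_nat => /eqP.
Qed.

Lemma desbits_equidistributed K K' T :
  perm_eq (map (count id) (desbits K T)) (map (count id) (desbits K' T)).
Proof.
elim: T K K' => [|l IHl r IHr] K K' //.
apply: perm_eq_genpoly; rewrite !big_map !big_desbits.
pose G x y := dotp (uweight ('X : {poly int}) (bsize l) x) (vweight 'X (bsize r) y).
have sumG K0 : \sum_(u <- desbits (lkind K0) l) \sum_(v <- desbits K0 r)
     \sum_(C <- masks (bsize l) (bsize r) | okmask K0 C)
        'X ^+ count id (false :: merge_des false C u v) =
   \sum_(x <- map (count id) (desbits (lkind K0) l))
     \sum_(y <- map (count id) (desbits K0 r)) G x y.
  rewrite big_map !big_seq; apply: eq_bigr => u /desbits_wf[su u0].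
  rewrite big_map !big_seq; apply: eq_bigr => v /desbits_wf[sv v0].
  by rewrite /G -su -sv -(sum_okmask _ K0).
rewrite !sumG (perm_big _ (IHl _ (lkind K'))); apply: eq_bigr => x _.
exact: perm_big.
Qed.

Local Open Scope nat_scope.


(** * Extreme letters and cutting a word at its least letter *)

Lemma seqmin_mem w : w != [::] -> seqmin w \in w.
Proof.
case: w => // x w _; rewrite /seqmin [head _ _]/=.
have mem_fold a s : foldr minn a s \in a :: s.
  elim: s => [|y s IH] /=; first by rewrite inE.
  rewrite /minn; case: ifP => _; rewrite !inE ?eqxx ?orbT //.
  by move: IH; rewrite inE => /orP[->|->]; rewrite ?orbT.
by have := mem_fold x (x :: w); rewrite !inE orbA orbb.
Qed.

Lemma seqmin_le w x : x \in w -> seqmin w <= x.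
Proof.
rewrite /seqmin; move: (head 0 w) => a; elim: w => //= y w IH.
by rewrite inE => /orP[/eqP <-|/IH le_x]; rewrite geq_min ?leqnn ?le_x ?orbT.
Qed.

Lemma seqmax_mem w : w != [::] -> seqmax w \in w.
Proof.
case: w => // x w _; rewrite /seqmax [head _ _]/=.
have mem_fold a s : foldr maxn a s \in a :: s.
  elim: s => [|y s IH] /=; first by rewrite inE.
  rewrite /maxn; case: ifP => _; rewrite !inE ?eqxx ?orbT //.
  by move: IH; rewrite inE => /orP[->|->]; rewrite ?orbT.
by have := mem_fold x (x :: w); rewrite !inE orbA orbb.
Qed.

Lemma seqmax_ge w x : x \in w -> x <= seqmax w.
Proof.
rewrite /seqmax; move: (head 0 w) => a; elim: w => //= y w IH.
by rewrite inE => /orP[/eqP <-|/IH le_x]; rewrite leq_max ?leqnn ?le_x ?orbT.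
Qed.

Lemma mem_neq_nil (x : nat) (w : seq nat) : x \in w -> w != [::].
Proof. by case: w. Qed.

Lemma seqmin_eq w m : m \in w -> {in w, forall x, m <= x} -> seqmin w = m.
Proof.
move=> mw lem; apply/eqP; rewrite eqn_leq seqmin_le //=.
exact/lem/seqmin_mem/(mem_neq_nil mw).
Qed.

Lemma seqmax_eq w m : m \in w -> {in w, forall x, x <= m} -> seqmax w = m.
Proof.
move=> mw lem; apply/eqP; rewrite eqn_leq seqmax_ge // andbT.
exact/lem/seqmax_mem/(mem_neq_nil mw).
Qed.

Lemma perm_seqmin w w' : perm_eq w w' -> seqmin w = seqmin w'.
Proof.
case: (w' =P [::]) => [->|/eqP w'n] eqw; first by rewrite (perm_nilP eqw).
apply: seqmin_eq; first by rewrite (perm_mem eqw) seqmin_mem.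
by move=> x; rewrite (perm_mem eqw) => /seqmin_le.
Qed.

Lemma perm_seqmax w w' : perm_eq w w' -> seqmax w = seqmax w'.
Proof.
case: (w' =P [::]) => [->|/eqP w'n] eqw; first by rewrite (perm_nilP eqw).
apply: seqmax_eq; first by rewrite (perm_mem eqw) seqmax_mem.
by move=> x; rewrite (perm_mem eqw) => /seqmax_ge.
Qed.

Lemma seqmin_root t m t' : all (ltn m) (t ++ t') -> seqmin (t ++ m :: t') = m.
Proof.
move=> /allP gtm; apply: seqmin_eq; first by rewrite mem_cat inE eqxx orbT.
move=> x; rewrite mem_cat inE orbCA => /orP[/eqP -> //|xt].
by apply/ltnW/gtm; rewrite mem_cat.
Qed.

Lemma index_root t m t' : all (ltn m) (t ++ t') -> index m (t ++ m :: t') = size t.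
Proof.
move=> /allP gtm; rewrite index_cat /= eqxx addn0 ifN //.
by apply/negP => mt; have := gtm m; rewrite mem_cat mt /= ltnn => /(_ isT).
Qed.

Lemma word_root_ind (P : seq nat -> Prop) :
  P [::] ->
  (forall t m t', uniq (t ++ m :: t') -> all (ltn m) (t ++ t') ->
     P t -> P t' -> P (t ++ m :: t')) ->
  forall w, uniq w -> P w.
Proof.
move=> P0 PS w; move: {2}(size w) (leqnn (size w)) => k.
elim: k w => [|k IH] w; first by rewrite leqn0 => /nilP ->.
case: (w =P [::]) => [-> //|/eqP /seqmin_mem].
move: (seqmin w) (@seqmin_le w) => m lem mw lek uw.
case/path.splitPr: mw lem lek uw => t t' lem lek uw.
move: (uw); rewrite cat_uniq /= => /and4P[ut /norP[mt _] mt' ut'].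
move: lek; rewrite size_cat /= addnS ltnS => lek.
apply: PS => //; first last.
- exact: IH (leq_trans (leq_addl _ _) lek) ut'.
- exact: IH (leq_trans (leq_addr _ _) lek) ut.
apply/allP => x xt; rewrite /= ltn_neqAle lem ?mem_cat ?inE ?andbT.
  by apply: contraTneq xt => <-; rewrite mem_cat negb_or mt.
by rewrite orbCA -mem_cat xt orbT.
Qed.

(** Both factors are shorter than the word, so fuel beyond the length changes nothing. *)
Lemma Psi_aux_fuel k w : size w <= k -> Psi_aux k w = Psi w.
Proof.
have PsiS n u : u != [::] -> Psi_aux n.+1 u =
    LNode (Psi_aux n (take (index (seqmin u) u) u)) (seqmin u)
          (Psi_aux n (drop (index (seqmin u) u).+1 u)) by case: u.
have fuel n n' u : size u <= n -> size u <= n' -> Psi_aux n u = Psi_aux n' u.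
  elim: n n' u => [|n IH] [|n'] [|x s] //; move: (x :: s) (isT : x :: s != [::]).
  move=> u u0 len len'; rewrite !PsiS //.
  have := seqmin_mem u0; rewrite -index_mem; move: (index _ _) => i lti.
  by congr LNode; apply: IH; rewrite ?size_take ?lti ?size_drop; move: lti len len'; rewrite /=; lia.
by move=> lek; apply: fuel.
Qed.

Lemma PsiE t m t' : all (ltn m) (t ++ t') ->
  Psi (t ++ m :: t') = LNode (Psi t) m (Psi t').
Proof.
move=> gtm; rewrite {1}/Psi size_cat /= addnS /= seqmin_root // index_root //.
rewrite take_size_cat // -cat_rcons drop_size_cat ?size_rcons // !Psi_aux_fuel ?leq_addl ?leq_addr //.
by case: t gtm.
Qed.

Definition andre (b : bool) (w : seq nat) : bool := andre_aux b (size w) w.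

Lemma andre_aux_fuel b k w : size w <= k -> andre_aux b k w = andre b w.
Proof.
have fuel : forall k k' w, size w <= k -> size w <= k' ->
    andre_aux b k w = andre_aux b k' w.
  elim=> [|n IH] [|n'] u lek lek' //=.
  - by rewrite ifT //; lia.
  - by rewrite ifT //; lia.
  case: ifP => // gt1; have /seqmin_mem : u != [::] by case: u gt1 {lek lek'}.
  rewrite -index_mem; move: (index _ _) => i lti.
  by congr [&& _, _ & _]; apply: IH; rewrite ?size_take ?lti ?size_drop; move: lti lek lek'; rewrite /=; lia.
by move=> lek; apply: fuel.
Qed.

(** The disjunct [nilp (t ++ t')] is the one-letter word, which has no extreme letter to place. *)
Lemma andreE b t m t' : all (ltn m) (t ++ t') ->
  andre b (t ++ m :: t') = nilp (t ++ t') ||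
    [&& andre b t, andre b t' &
        (if b then seqmax (t ++ t') else seqmin (t ++ t')) \in t'].
Proof.
move=> gtm; rewrite {1}/andre size_cat /= addnS /= seqmin_root // index_root //.
rewrite size_cat /= addnS ltnS leqn0 -size_cat -/(nilp _); case: ifP => // _.
rewrite take_size_cat // -cat_rcons drop_size_cat ?size_rcons //.
by rewrite !andre_aux_fuel ?size_cat ?leq_addl ?leq_addr //; case: b.
Qed.

Lemma AndreIE t m t' : all (ltn m) (t ++ t') ->
  AndreI (t ++ m :: t') = nilp (t ++ t') ||
    [&& AndreI t, AndreI t' & seqmax (t ++ t') \in t'].
Proof. exact: (@andreE true). Qed.

Lemma AndreIIE t m t' : all (ltn m) (t ++ t') ->
  AndreII (t ++ m :: t') = nilp (t ++ t') ||
    [&& AndreII t, AndreII t' & seqmin (t ++ t') \in t'].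
Proof. exact: (@andreE false). Qed.

(** * Double descents and the recursion for simsun words *)

Lemma ndd_cons3 x y z w :
  no_double_descent [:: x, y, z & w] =
  ~~ ((y < x) && (z < y)) && no_double_descent [:: y, z & w].
Proof.
rewrite /no_double_descent /= !subSS subn0; congr andb.
by rewrite (iotaDl 1 0) all_map.
Qed.

(** A double descent lies up to [p], lies from [p] on, or has [p] as its middle letter. *)
Lemma ndd_cat s1 p s2 :
  no_double_descent (s1 ++ p :: s2) =
  [&& no_double_descent (rcons s1 p), no_double_descent (p :: s2) &
      ~~ [&& s1 != [::], s2 != [::], p < last p s1 & head p s2 < p]].
Proof.
elim: s1 => [|x s1 IH]; first by rewrite /= andbT.
case: s1 IH => [_|y s1 IH].
  case: s2 => [|z s2] //; rewrite ndd_cons3 /= andbC; congr andb.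
rewrite [rcons _ _]/= !cat_cons; case: s1 IH => [|z s1] IH.
  by rewrite ndd_cons3 [_ ++ _]/= in IH *; rewrite IH /= -!andbA.
by rewrite [rcons _ _]/= !cat_cons !ndd_cons3 -!cat_cons IH -!andbA.
Qed.

Lemma ndd_cons p s : all (ltn p) s -> no_double_descent (p :: s) = no_double_descent s.
Proof.
by case: s => [|x [|y s]] // /andP[ltpx _]; rewrite ndd_cons3 ltnNge (ltnW ltpx).
Qed.

Lemma ndd_root s1 p s2 : all (ltn p) s2 ->
  no_double_descent (s1 ++ p :: s2) = no_double_descent (rcons s1 p) && no_double_descent s2.
Proof.
move=> gtp; rewrite ndd_cat ndd_cons //; congr andb.
case: s2 gtp => [|x s2] /=; first by rewrite andbF.
by move=> /andP[ltpx _]; rewrite [x < p]ltnNge (ltnW ltpx) /= !andbF andbT.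
Qed.

(** Only [m] is below [p], so [p] is the middle of a double descent just when [s2] is empty and [s1]
    is not: a left child without a right one. *)
Lemma ndd_root_rcons s1 p s2 m : m < p -> all (ltn p) (s1 ++ s2) ->
  no_double_descent (rcons (s1 ++ p :: s2) m) =
  [&& no_double_descent (rcons s1 p), no_double_descent (rcons s2 m) &
      nilp s2 ==> nilp s1].
Proof.
move=> ltmp; rewrite all_cat => /andP[gt1 gt2].
rewrite rcons_cat rcons_cons ndd_cat; congr andb.
case: s2 gt2 => [|x s2] /= gt2.
  rewrite ltmp andbT; case/lastP: s1 gt1 => //= s1 y.
  by rewrite all_rcons last_rcons -size_eq0 size_rcons /nilp size_rcons => /andP[/= -> _].
case/andP: gt2 => ltpx _; rewrite [x < p]ltnNge (ltnW ltpx) /= !andbF !andbT.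
by case: s2 => [|y s2] //=; rewrite ndd_cons3 ltnNge (ltnW ltpx).
Qed.

Lemma nilp_filter (a : pred nat) s : nilp (filter a s) = ~~ has a s.
Proof. by rewrite has_filter -size_eq0 /nilp negbK. Qed.

Lemma filter_le_nil k p s : k < p -> all (ltn p) s -> [seq x <- s | x <= k] = [::].
Proof.
move=> ltkp /allP gts; apply/eqP; rewrite -size_eq0 -/(nilp _) nilp_filter.
by apply/hasPn => x /gts ltpx; rewrite -ltnNge; apply: ltn_trans ltkp ltpx.
Qed.

(* [m] stands for the root to the left of which [w] hangs: a vertex at the end
   of [w] with a left but no right child then yields a double descent. *)
Lemma andreII_ndd w m : uniq w -> all (ltn m) w ->
  (forall k, no_double_descent (rcons [seq x <- w | x <= k] m)) <-> AndreII w.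
Proof.
move=> uw; move: w uw m; apply: word_root_ind => [|t p t' utt' gtp IHt IHt'] m //.
rewrite all_cat /= => /and3P[gtt ltmp gtt'].
rewrite AndreIIE //.
have ftE k : no_double_descent (rcons [seq x <- t ++ p :: t' | x <= k] m) =
  [&& no_double_descent (rcons [seq x <- t | x <= k] p),
      no_double_descent (rcons [seq x <- t' | x <= k] m) &
      has [pred x | x <= k] t ==> has [pred x | x <= k] t'].
  rewrite filter_cat /=; case: leqP => [lepk|ltkp].
    rewrite ndd_root_rcons // ?nilp_filter ?implybNN // -filter_cat.
    by rewrite all_filter; apply: sub_all gtp => x /= ->; rewrite implybT.
  move: gtp; rewrite all_cat => /andP[gt gt'].
  by rewrite !has_filter !(filter_le_nil ltkp).
move: (gtp); rewrite all_cat => /andP[gt gt'].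
have {}IHt := IHt p gt; have {}IHt' := IHt' m gtt'.
(* The least letter lies in [t'] when every threshold reaching [t] also reaches [t']; the threshold
   to test is that least letter. *)
have minE : nilp (t ++ t') || (seqmin (t ++ t') \in t') <->
    forall k, has [pred x | x <= k] t -> has [pred x | x <= k] t'.
  split=> [/orP[/nilP tt0|mint'] k /hasP[x xt /= lexk]|hs].
  - by case: (t) xt tt0.
  - apply/hasP; exists (seqmin (t ++ t')) => //=.
    by apply: leq_trans lexk; apply: seqmin_le; rewrite mem_cat xt.
  case: (t ++ t' =P [::]) => [->//|/eqP/seqmin_mem]; rewrite mem_cat.
  case/orP=> [mint|->]; last by rewrite orbT.
  have /hs/hasP[x xt' /= lex] : has [pred x | x <= seqmin (t ++ t')] t.
    by apply/hasP; exists (seqmin (t ++ t')) => /=.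
  have -> : seqmin (t ++ t') = x by apply/eqP; rewrite eqn_leq lex seqmin_le // mem_cat xt' orbT.
  by rewrite xt' orbT.
split=> [h|].
  have At : AndreII t by apply/IHt => k; have := h k; rewrite ftE => /and3P[].
  have At' : AndreII t' by apply/IHt' => k; have := h k; rewrite ftE => /and3P[].
  rewrite At At' /=; apply/minE => k; have := h k; rewrite ftE => /and3P[_ _ /implyP //].
case/orP=> [nil_tt' k|/and3P[/IHt At /IHt' At' mint'] k]; rewrite ftE.
  by move/nilP: nil_tt'; case: (t) => // /= ->.
by rewrite At At'; apply/implyP; apply: (minE.1 _ k); rewrite mint' orbT.
Qed.

(** Simsun over an arbitrary alphabet, so that the recursion applies to factors. *)
Definition rsimsun (w : seq nat) : bool :=
  (last 0 w == seqmax w) && all (fun k => no_double_descent [seq x <- w | x <= k]) w.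

(** A threshold keeps the same letters as the largest letter it keeps. *)
Lemma all_ndd w :
  all (fun k => no_double_descent [seq x <- w | x <= k]) w <->
  (forall k, no_double_descent [seq x <- w | x <= k]).
Proof.
split=> [/allP h k|h]; last by apply/allP.
case: ([seq x <- w | x <= k] =P [::]) => [->//|/eqP/seqmax_mem].
rewrite mem_filter => /andP[le_k /h]; congr no_double_descent.
apply: eq_in_filter => x xw; apply/idP/idP => [le_x|le_x]; first exact: leq_trans le_k.
by apply: seqmax_ge; rewrite mem_filter le_x.
Qed.

(** The root [m] can only be the last letter of a double descent. So it closes the restrictions of
    [t], giving André II by [andreII_ndd], and leaves those of [t'] alone. *)
Lemma rsimsunE t m t' : uniq (t ++ m :: t') -> all (ltn m) (t ++ t') ->
  rsimsun (t ++ m :: t') = nilp (t ++ t') ||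
    [&& AndreII t, rsimsun t' & seqmax (t ++ t') \in t'].
Proof.
move=> utt' gtm; move: (gtm); rewrite all_cat => /andP[gt gt'].
have ut : uniq t by move: utt'; rewrite cat_uniq => /and3P[].
have nddE : (forall k, no_double_descent [seq x <- t ++ m :: t' | x <= k]) <->
    AndreII t /\ (forall k, no_double_descent [seq x <- t' | x <= k]).
  rewrite -(andreII_ndd ut gt).
  have ftE k : no_double_descent [seq x <- t ++ m :: t' | x <= k] =
    no_double_descent (rcons [seq x <- t | x <= k] m) &&
    no_double_descent [seq x <- t' | x <= k].
    rewrite filter_cat /=; case: leqP => [lemk|ltkm].
      rewrite ndd_root // all_filter; apply: sub_all gt' => x /= ->.
      by rewrite implybT.
    by rewrite !(filter_le_nil ltkm).
  split=> [h|[h h'] k]; last by rewrite ftE h h'.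
  by split=> k; have := h k; rewrite ftE => /andP[].
have maxE : t ++ t' != [::] -> seqmax (t ++ m :: t') = seqmax (t ++ t').
  move=> tt0; apply: seqmax_eq => [|x].
    by move: (seqmax_mem tt0); rewrite !mem_cat inE orbCA => ->; rewrite orbT.
  rewrite mem_cat inE orbCA -mem_cat => /orP[/eqP ->|/seqmax_ge //].
  by apply/ltnW/(allP gtm)/seqmax_mem.
rewrite /rsimsun last_cat /=.
case: (t ++ t' =P [::]) => [tt0|/eqP tt0].
  move: tt0 {nddE maxE utt' gtm gt gt' ut}; case: t; case: t' => //= _.
  by rewrite /seqmax /= maxnn eqxx /= leqnn.
(* If [t'] is empty the last letter is [m], below the maximum; otherwise the default of [last] is
   immaterial. *)
have lastE : (last m t' == seqmax (t ++ t')) =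
    (last 0 t' == seqmax t') && (seqmax (t ++ t') \in t').
  apply/eqP/andP => [lastm|[/eqP lastm mt']].
    have mt' : seqmax (t ++ t') \in t'.
      have := mem_last m t'; rewrite lastm inE => /orP[/eqP eqm|//].
      by have /(allP gtm) := seqmax_mem tt0; rewrite /= eqm ltnn.
    split=> //; have <- : last m t' = last 0 t' by case: (t') mt'.
    rewrite lastm; apply/eqP/esym; apply: seqmax_eq => // x xt'.
    by apply: seqmax_ge; rewrite mem_cat xt' orbT.
  have -> : last m t' = last 0 t' by case: (t') mt'.
  rewrite lastm; apply/esym; apply: seqmax_eq => [|x].
    by rewrite mem_cat seqmax_mem ?orbT // (mem_neq_nil mt').
  move=> /seqmax_ge /leq_trans; apply; exact: seqmax_ge.
rewrite maxE // lastE [nilp _](_ : _ = false); last by rewrite /nilp size_eq0 (negbTE tt0).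
rewrite orFb -!andbA.
apply/and3P/and4P => [[lt' mt' /all_ndd/nddE[At /all_ndd nt']]|[At lt' nt' mt']] //.
by split=> //; apply/all_ndd/nddE; split=> //; apply/all_ndd.
Qed.

Lemma simsunE n w : 0 < n -> perm_eq w (iota 1 n) -> simsun n w = rsimsun w.
Proof.
move=> n0 pw; rewrite /simsun /rsimsun.
have -> : seqmax w = n.
  rewrite (perm_seqmax pw); apply: seqmax_eq => [|x]; rewrite mem_iota; lia.
by congr andb; apply/esym/perm_all.
Qed.

Lemma size_shape_Psi w : uniq w -> bsize (Defs.shape (Psi w)) = size w.
Proof.
move: w; apply: word_root_ind => // t m t' _ gtm IH IH'.
by rewrite PsiE //= IH IH' size_cat /= addnS.
Qed.

(** * The three families over a sorted alphabet, and their inverse descents *)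

Definition valid (K : kind) (w : seq nat) : bool :=
  match K with KI => AndreI w | KII => AndreII w | KRS => rsimsun w end.

Lemma valid_nil K : valid K [::].
Proof. by case: K. Qed.

Lemma validE K t m t' : uniq (t ++ m :: t') -> all (ltn m) (t ++ t') ->
  valid K (t ++ m :: t') = nilp (t ++ t') ||
    [&& valid (lkind K) t, valid K t' &
        (if K is KII then seqmin (t ++ t') else seqmax (t ++ t')) \in t'].
Proof.
move=> utt' gtm; case: K => /=; [exact: AndreIE|exact: AndreIIE|exact: rsimsunE].
Qed.

Lemma perm_mask_negb (T : eqType) (C : bitseq) (s : seq T) : size C = size s ->
  perm_eq (mask C s ++ mask (map negb C) s) s.
Proof.
elim: s C => [|x s IH] [|c C] //= [/IH eqs]; case: c => /=; first by rewrite perm_cons.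
by rewrite -cat1s perm_catCA perm_cons.
Qed.

(** Recovers a mask from the letters it selects, whence the uniqueness in [words_node]. *)
Lemma mem_mask_map (T : eqType) (C : bitseq) (s : seq T) :
  uniq s -> size C = size s -> [seq x \in mask C s | x <- s] = C.
Proof.
elim: s C => [|x s IH] [|c C] //= /andP[xs us] [eqs].
have xC : x \notin mask C s by apply: contra xs; apply: mem_mask.
congr cons; first by case: c; rewrite /= ?inE ?eqxx // (negbTE xC).
rewrite -[RHS](IH C us eqs); apply/eq_in_map => y ys.
case: c => //=; rewrite inE; case: eqP => // eyx.
by rewrite -eyx ys in xs.
Qed.

Lemma ltn_sorted_uniq (s : seq nat) : sorted ltn s -> uniq s.
Proof. by rewrite ltn_sorted_uniq_leq => /andP[]. Qed.

Lemma okmaskE K C s t t' : sorted ltn s -> size C = size s ->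
  perm_eq t (mask C s) -> perm_eq t' (mask (map negb C) s) ->
  okmask K C = nilp s ||
    ((if K is KII then seqmin (t ++ t') else seqmax (t ++ t')) \in t').
Proof.
move=> ss eqs pt pt'.
have ptt' : perm_eq (t ++ t') s by apply: perm_trans (perm_mask_negb eqs); apply: perm_cat.
rewrite (perm_seqmin ptt') (perm_seqmax ptt').
have hd : ~~ head false C = nilp s || (seqmin s \in mask (map negb C) s).
  case: s ss eqs {pt pt' ptt'} => [|x s]; case: C => //= c C ss [eqs].
  have us : uniq (x :: s) by apply: ltn_sorted_uniq.
  rewrite (@seqmin_eq _ x) ?mem_head //; last first.
    move=> y; rewrite inE => /orP[/eqP -> //|ys].
    by move: ss; rewrite (path_sortedE ltn_trans) => /andP[/allP/(_ _ ys)/ltnW].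
  case: c => /=; rewrite ?mem_head //; apply/esym/negbTE.
  by move: us => /= /andP[xs _]; apply: contra xs; apply: mem_mask.
have tl : ~~ last false C = nilp s || (seqmax s \in mask (map negb C) s).
  case/lastP: s ss eqs {pt pt' ptt' hd} => [|s y]; case/lastP: C => [|C c]; rewrite ?size_rcons //.
  move=> ss [eqs]; rewrite last_rcons map_rcons mask_rcons ?size_map // /nilp size_rcons /=.
  have us : uniq (rcons s y) by apply: ltn_sorted_uniq.
  rewrite (@seqmax_eq _ y) ?mem_rcons ?mem_head //; last first.
    move=> x; rewrite mem_rcons inE => /orP[/eqP -> //|xs].
    by move: ss; rewrite (sorted_pairwise ltn_trans) pairwise_rcons => /andP[/allP/(_ _ xs)/ltnW].
  rewrite mem_cat; case: c => /=; rewrite ?mem_head ?orbT // in_nil orbF.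
  apply/esym/negbTE.
  by move: us; rewrite rcons_uniq => /andP[ys _]; apply: contra ys; apply: mem_mask.
by case: K; rewrite (perm_mem pt').
Qed.

Definition words (K : kind) (T : btree) (ls : seq nat) : seq (seq nat) :=
  [seq w <- permutations ls | valid K w && (Defs.shape (Psi w) == T)].

Lemma mem_words K T ls w :
  (w \in words K T ls) = [&& valid K w, Defs.shape (Psi w) == T & perm_eq w ls].
Proof. by rewrite mem_filter mem_permutations andbA. Qed.

Lemma words_uniq K T ls : uniq (words K T ls).
Proof. by rewrite filter_uniq // permutations_uniq. Qed.

Lemma mem_words_root K l r m ls C t t' :
  path ltn m ls -> size C = size ls ->
  perm_eq t (mask C ls) -> perm_eq t' (mask (map negb C) ls) ->
  (t ++ m :: t' \in words K (BNode l r) (m :: ls)) =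
  [&& okmask K C, t \in words (lkind K) l (mask C ls) &
      t' \in words K r (mask (map negb C) ls)].
Proof.
move=> pls eqs pt pt'; rewrite !mem_words pt pt' !andbT.
have ptt' : perm_eq (t ++ t') ls by apply: perm_trans (perm_mask_negb eqs); apply: perm_cat.
have pw : perm_eq (t ++ m :: t') (m :: ls).
  by rewrite -cat1s perm_catCA perm_cons.
have gtm : all (ltn m) (t ++ t') by rewrite (perm_all _ ptt'); apply: order_path_min ltn_trans pls.
have uw : uniq (t ++ m :: t').
  by rewrite (perm_uniq pw); apply: ltn_sorted_uniq.
rewrite pw andbT PsiE //= validE // (@okmaskE _ _ _ t t' (path_sorted pls) eqs) //.
have -> : nilp (t ++ t') = nilp ls by rewrite /nilp (perm_size ptt').
have -> : (BNode (Defs.shape (Psi t)) (Defs.shape (Psi t')) == BNode l r) =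
    (Defs.shape (Psi t) == l) && (Defs.shape (Psi t') == r) by [].
case: nilP => [ls0|_] /=; last first.
  by case: (valid _ t); case: (valid _ t'); case: (_ \in t'); case: (_ == l); rewrite //= ?andbF.
move: ptt'; rewrite ls0 => /perm_nilP; case: (t); case: (t') => //= _.
by rewrite !valid_nil.
Qed.

Lemma words_node K l r m ls : path ltn m ls -> size ls = bsize l + bsize r ->
  perm_eq (words K (BNode l r) (m :: ls))
    [seq q.1 ++ m :: q.2 |
       C <- [seq C <- masks (bsize l) (bsize r) | okmask K C],
       q <- [seq (t, t') | t <- words (lkind K) l (mask C ls),
                           t' <- words K r (mask (map negb C) ls)]].
Proof.
move=> pls szls.
have /= /andP[mls uls] : uniq (m :: ls) by apply: ltn_sorted_uniq.
have mtP K0 T C t : t \in words K0 T (mask C ls) -> m \notin t.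
  rewrite mem_words => /and3P[_ _ /perm_mem pt].
  by apply: contra mls; rewrite pt; apply: mem_mask.
apply: uniq_perm; first exact: words_uniq.
  apply: allpairs_uniq_dep => [|C _|].
  - by rewrite filter_uniq // masks_uniq.
  - by apply: allpairs_uniq; rewrite ?words_uniq // => -[? ?] [? ?].
  move=> _ _ /allpairsPdep[C [_ [Cm /allpairsP[[t t'] /= [tw tw' ->]] ->]]]
             /allpairsPdep[C2 [_ [Cm2 /allpairsP[[u u'] /= [uw uw' ->]] ->]]] /=.
  move=> eqtu.
  have sztu : size t = size u.
    (* The position of [m] determines where the word is cut. *)
    have := congr1 (index m) eqtu.
    by rewrite !index_cat (negbTE (mtP _ _ _ _ tw)) (negbTE (mtP _ _ _ _ uw)) /= eqxx !addn0.
  move/eqP: eqtu; rewrite eqseq_cat // eqseq_cons eqxx /= => /andP[/eqP etu /eqP etu'].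
  suff eC : C = C2 by rewrite etu etu' eC.
  move: Cm Cm2; rewrite !mem_filter => /andP[_ /size_mask_of sC] /andP[_ /size_mask_of sC2].
  rewrite -szls in sC sC2.
  rewrite -(mem_mask_map uls sC) -(mem_mask_map uls sC2); apply: eq_map => x.
  move: tw uw; rewrite !mem_words => /and3P[_ _ /perm_mem <-] /and3P[_ _ /perm_mem <-].
  by rewrite etu.
move=> w; apply/idP/allpairsPdep => [ww|[C [_ [Cm /allpairsP[[t t'] /= [tw tw' ->]] ->]]]].
  have pw : perm_eq w (m :: ls) by move: ww; rewrite mem_words => /and3P[].
  have mw : m \in w by rewrite (perm_mem pw) mem_head.
  case/path.splitPr: mw pw ww => t t' pw.
  have ptt' : perm_eq (t ++ t') ls by rewrite -(perm_cons m) -(permPr pw) -cat1s perm_catCA.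
  have /[!cat_uniq]/and3P[ut ntt' ut'] : uniq (t ++ t') by rewrite (perm_uniq ptt').
  (* The mask marks the letters standing to the left of the root. *)
  pose C := [seq x \in t | x <- ls].
  have sC : size C = size ls by rewrite size_map.
  have pt : perm_eq t (mask C ls).
    rewrite -filter_mask; apply: uniq_perm; rewrite ?filter_uniq // => x.
    by rewrite mem_filter /= -(perm_mem ptt') mem_cat; case: (x \in t).
  have pt' : perm_eq t' (mask (map negb C) ls).
    rewrite -map_comp -filter_mask; apply: uniq_perm; rewrite ?filter_uniq // => x.
    rewrite mem_filter /= -(perm_mem ptt') mem_cat.
    case xt: (x \in t) => //=; apply/negbTE; apply: contra ntt' => xt'.
    by apply/hasP; exists x.
  rewrite (mem_words_root _ _ _ pls sC pt pt') => /and3P[okC tw tw'].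
  exists C, (t, t'); split=> //; last by apply/allpairsP; exists (t, t').
  rewrite mem_filter okC mem_masks.
  have cntC : count id C = bsize l.
    rewrite -(size_mask sC) -(perm_size pt) -size_shape_Psi //.
    by move: tw; rewrite mem_words => /and3P[_ /eqP -> _].
  rewrite cntC eqxx -(eqn_add2l (bsize l)) -szls -sC -{1}cntC.
  by rewrite /= -(count_predC id C).
move: Cm; rewrite mem_filter => /andP[okC /size_mask_of sC]; rewrite -szls in sC.
rewrite (@mem_words_root _ _ _ _ _ C) //=; first by rewrite okC tw tw'.
- by move: tw; rewrite mem_words => /and3P[].
- by move: tw'; rewrite mem_words => /and3P[].
Qed.

(* Relative to the sorted alphabet [ls]; the leading bit compares the least
   letter with itself, hence is [false]. *)
Definition idesbits (ls w : seq nat) : bitseq :=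
  pairmap (fun a b => index b w < index a w) (head 0 ls) ls.

(** Positions in [t] are kept and those in [m :: t'] shift by [size t]. Comparisons inside a factor
    survive; passing to [t] is always a descent, leaving it never. Here [xu], [xv] are the last
    letters read in each factor. *)
Lemma pairmap_root (t : seq nat) m t' (C : bitseq) s (c : bool) xu xv :
  uniq (t ++ m :: t') -> size C = size s ->
  {subset mask C s <= t} -> {subset mask (map negb C) s <= t'} ->
  (c -> xu \in t) -> xv \in m :: t' ->
  pairmap (fun a b => index b (t ++ m :: t') < index a (t ++ m :: t'))
          (if c then xu else xv) s =
  merge_des c C (pairmap (fun a b => index b t < index a t) xu (mask C s))
    (pairmap (fun a b => index b (m :: t') < index a (m :: t')) xv (mask (map negb C) s)).
Proof.
rewrite cat_uniq => /and3P[_ /hasPn disj _].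
elim: s C c xu xv => [|y s IH] [|b C] // c xu xv [sC] sub sub' cxu xvt'.
have iL x : x \in t -> index x (t ++ m :: t') = index x t by move=> xt; rewrite index_cat xt.
have iR x : x \in m :: t' -> index x (t ++ m :: t') = size t + index x (m :: t').
  by move=> /disj xt; rewrite index_cat (negbTE xt).
case: b sub sub' => /= sub sub'.
  have yt : y \in t by apply: sub; rewrite mem_head.
  congr cons; last first.
    by apply: (IH C true) => // x xC; apply: sub; rewrite inE xC orbT.
  case: c cxu => [/(_ isT) xut|_]; first by rewrite !iL.
  by rewrite iL // iR // (leq_trans _ (leq_addr _ _)) // index_mem.
have yt : y \in t' by apply: sub'; rewrite mem_head.
have yt' : y \in m :: t' by rewrite inE yt orbT.
congr cons; last first.
  by apply: (IH C false) => // x xC; apply: sub'; rewrite inE xC orbT.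
case: c cxu => [/(_ isT) xut|_]; last by rewrite !iR // ltn_add2l.
rewrite (iL _ xut) (iR _ yt'); apply/negbTE; rewrite -leqNgt ltnW //.
by rewrite (leq_trans _ (leq_addr _ _)) // index_mem.
Qed.

Lemma idesbits_root (t : seq nat) m t' C ls :
  uniq (t ++ m :: t') -> size C = size ls ->
  perm_eq t (mask C ls) -> perm_eq t' (mask (map negb C) ls) ->
  idesbits (m :: ls) (t ++ m :: t') =
  false :: merge_des false C (idesbits (mask C ls) t) (idesbits (mask (map negb C) ls) t').
Proof.
move=> uw sC pt pt'; rewrite /idesbits /= ltnn; congr cons.
rewrite (@pairmap_root t m t' C ls false (head 0 (mask C ls)) m) ?mem_head //; first last.
- by move=> x; rewrite (perm_mem pt').
- by move=> x; rewrite (perm_mem pt).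
congr merge_des; have mt' : m \notin t' by move: uw; rewrite cat_uniq /= => /and4P[].
have : {subset mask (map negb C) ls <= t'} by move=> x; rewrite (perm_mem pt').
(* Dropping [m] is harmless: the first letter gives [false] against [m] as against itself, and other
   positions shift by one. *)
case: (mask _ _) => [|y s] //= sub; rewrite eqxx ltnn; congr cons.
have yt' : y \in t' by apply: sub; rewrite mem_head.
have {sub} : all (mem t') s by apply/allP => x xs; apply: sub; rewrite inE xs orbT.
have neq_m x : x \in t' -> (m == x) = false by move=> xt'; apply: contraNF mt' => /eqP ->.
elim: s y yt' => //= z s IH y yt' /andP[zt' st'].
by rewrite !neq_m // ltnS IH.
Qed.

(** Ties the actual words to the model [desbits]; [f] is arbitrary so that the induction can run
    inside nested sums. *)
Lemma big_words (V : nmodType) K T ls (f : bitseq -> V) :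
  sorted ltn ls -> size ls = bsize T ->
  (\sum_(w <- words K T ls) f (idesbits ls w) = \sum_(d <- desbits K T) f d)%R.
Proof.
elim: T K ls f => [|l IHl r IHr] K ls f.
  move=> _ /size0nil ->; rewrite (perm_big [:: [::]]) ?big_seq1 //.
  apply: uniq_perm; rewrite ?words_uniq // => w.
  rewrite mem_words inE; case: w => [|x w]; first by rewrite valid_nil.
  by apply/negbTE/negP => /and3P[_ _ /perm_size].
case: ls => //= m ls pls [szls].
rewrite (perm_big _ (words_node K pls szls)) !big_allpairs_dep.
rewrite big_seq [RHS]big_seq; apply: eq_bigr => C.
rewrite mem_filter mem_masks => /and3P[_ /eqP cntC /eqP cntC'].
have sC : size C = size ls by rewrite szls -cntC -cntC' count_predC.
have sC' : size (map negb C) = size ls by rewrite size_map.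
rewrite !big_allpairs_dep /=.
have sm (D : bitseq) : sorted ltn (mask D ls).
  by apply: (subseq_sorted ltn_trans (mask_subseq _ _)); apply: path_sorted pls.
under [RHS]eq_bigr => u _ do rewrite -(IHr K (mask (map negb C) ls)) ?size_mask ?count_map //.
(* The hypothesis for [l] is applied to the whole inner sum, as a function of the bits of the left
   factor. *)
rewrite -(IHl (lkind K) (mask C ls)
   (fun u => (\sum_(w <- words K r (mask (map negb C) ls))
      f (false :: merge_des false C u (idesbits (mask (map negb C) ls) w)))%R)) ?size_mask //.
rewrite big_seq [RHS]big_seq; apply: eq_bigr => t; rewrite mem_words => /and3P[_ _ pt].
rewrite big_seq [RHS]big_seq; apply: eq_bigr => t'; rewrite mem_words => /and3P[_ _ pt'].
rewrite (@idesbits_root _ _ _ C) //.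
have ptt' : perm_eq (t ++ t') ls by apply: perm_trans (perm_mask_negb sC); apply: perm_cat.
rewrite -cat1s uniq_catCA cat1s /= (perm_mem ptt') (perm_uniq ptt').
exact: (@ltn_sorted_uniq (m :: ls)) pls.
Qed.

Lemma ides_idesbits n w : 0 < n -> ides n w = count id (idesbits (iota 1 n) w).
Proof.
case: n => // n _; rewrite /ides /idesbits /= ltnn add0n.
by elim: n 1 => //= n IH a; rewrite IH.
Qed.

Local Open Scope ring_scope.

Theorem theorem2p5 (R : comNzRingType) (s : R) (n : nat) (T : btree) :
  (1 <= n)%N -> url T -> bsize T = n ->
  (\sum_(sigma <- And1 n T) s ^+ ides n sigma =
   \sum_(sigma <- And2 n T) s ^+ ides n sigma) /\
  (\sum_(sigma <- And2 n T) s ^+ ides n sigma =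
   \sum_(sigma <- RS n T) s ^+ ides n sigma).
Proof.
move=> n0 _ szT.
have RSE : RS n T = words KRS T (iota 1 n).
  apply: eq_in_filter => w; rewrite mem_permutations => pw.
  by rewrite (simsunE n0 pw).
(* The kind [KI] on the right is an arbitrary common reference for all three. *)
have sumE K : \sum_(w <- words K T (iota 1 n)) s ^+ ides n w =
    \sum_(i <- map (count id) (desbits KI T)) s ^+ i.
  rewrite (perm_big _ (desbits_equidistributed KI K T)) big_map.
  rewrite -(@big_words _ K T (iota 1 n)) ?size_iota ?iota_ltn_sorted //.
  by apply: eq_bigr => w _; rewrite ides_idesbits.
by rewrite RSE (sumE KI) (sumE KII) (sumE KRS).
Qed.
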